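(* $LTS(\mathrm{CLL}_R)$ is a Logic LTS, i.e. for every process $p$: (LTS1) if there is $\alpha\in\mathcal I(p)$ such that every $q$ with $p\stackrel{\alpha}{\longrightarrow}q$ satisfies $q\in F$, then $p\in F$; (LTS2) if there is no $q$ with $p\stackrel{\epsilon}{\Longrightarrow}_F|q$, then $p\in F$.
   Context: Fix a set $Act$ of visible actions and let $Act_\tau=Act\cup\{\tau\}$; $a$ ranges over $Act$, $\alpha$ over $Act_\tau$. Terms of $\mathrm{CLL}_R$: $t::=0\mid\bot\mid\alpha.t\mid t\Box t\mid t\wedge t\mid t\vee t\mid t\parallel_A t\mid X\mid\langle X|E\rangle$, where $X$ is a variable, $A\subseteq Act$, and $E$ is a recursive specification, i.e. a finite nonempty set of equations $\{Y=t_Y:Y\in V\}$ over a set $V$ of variables with $X\in V$ (variables of $V$ are bound in $\langle X|E\rangle$; recursive variables of distinct specifications are distinct and never occur free). A process is a closed term. For $E$ over $V$, $\langle t|E\rangle$ is $t$ with every free occurrence of each $Y\in V$ replaced by $\langle Y|E\rangle$. All recursive specifications are assumed guarded: every occurrence of every $Y\in V$ in every right-hand side of $E$ lies within a subterm $\alpha.t'$ or $t_1\vee t_2$. $LTS(\mathrm{CLL}_R)$ has the processes as states, transitions $\stackrel{\alpha}{\longrightarrow}$ and inconsistency predicate $F$ given by the unique stable model of the following stratified transition system specification ($x\not\stackrel{\alpha}{\longrightarrow}$: no $\alpha$-transition; $z\stackrel{\epsilon}{\Longrightarrow}|y$: $z(\stackrel{\tau}{\longrightarrow})^*y$ and $y\not\stackrel{\tau}{\longrightarrow}$).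 Operational rules: $\alpha.x\stackrel{\alpha}{\to}x$; if $x_1\stackrel{a}{\to}y_1$, $x_2\not\stackrel{\tau}{\to}$ then $x_1\Box x_2\stackrel a\to y_1$ and $x_2\Box x_1\stackrel a\to y_1$; if $x_1\stackrel\tau\to y_1$ then $x_1\Box x_2\stackrel\tau\to y_1\Box x_2$, $x_2\Box x_1\stackrel\tau\to x_2\Box y_1$, $x_1\wedge x_2\stackrel\tau\to y_1\wedge x_2$, $x_2\wedge x_1\stackrel\tau\to x_2\wedge y_1$, $x_1\parallel_A x_2\stackrel\tau\to y_1\parallel_A x_2$, $x_2\parallel_A x_1\stackrel\tau\to x_2\parallel_A y_1$; if $x_1\stackrel a\to y_1$, $x_2\stackrel a\to y_2$ then $x_1\wedge x_2\stackrel a\to y_1\wedge y_2$, and if also $a\in A$ then $x_1\parallel_A x_2\stackrel a\to y_1\parallel_A y_2$; if $a\notin A$, $x_1\stackrel a\to y_1$, $x_2\not\stackrel\tau\to$ then $x_1\parallel_A x_2\stackrel a\to y_1\parallel_A x_2$ and $x_2\parallel_A x_1\stackrel a\to x_2\parallel_A y_1$; $x_1\vee x_2\stackrel\tau\to x_1$, $x_1\vee x_2\stackrel\tau\to x_2$; if $Y=t_Y\in E$ and $\langle t_Y|E\rangle\stackrel\alpha\to y$ then $\langle Y|E\rangle\stackrel\alpha\to y$. Predicate rules: $\bot\in F$; $x\in F\Rightarrow\alpha.x\in F$; $x_1,x_2\in F\Rightarrow x_1\vee x_2\in F$; if $x_1\in F$ or $x_2\in F$ then $x_1\Box x_2, x_1\parallel_A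 x_2, x_1\wedge x_2\in F$; if $x_1\wedge x_2\not\stackrel\tau\to$ and one of $x_1,x_2$ has an $a$-transition while the other has none, then $x_1\wedge x_2\in F$; if $x_1\wedge x_2\stackrel\alpha\to z$ for some $z$ and all $y$ with $x_1\wedge x_2\stackrel\alpha\to y$ are in $F$, then $x_1\wedge x_2\in F$; if all $y$ with $x_1\wedge x_2\stackrel\epsilon\Longrightarrow|y$ are in $F$ then $x_1\wedge x_2\in F$; if $Y=t_Y\in E$ and $\langle t_Y|E\rangle\in F$ then $\langle Y|E\rangle\in F$; if all $y$ with $\langle Y|E\rangle\stackrel\epsilon\Longrightarrow|y$ are in $F$ then $\langle Y|E\rangle\in F$. Notation: $\mathcal I(p)=\{\alpha:\exists q.\,p\stackrel\alpha\to q\}$; $p$ is stable iff $\tau\notin\mathcal I(p)$; $p\stackrel\epsilon\Longrightarrow_F|q$ means there is a sequence of $\tau$-transitions from $p$ to $q$ all of whose states (including $p$ and $q$) are not in $F$, and $q$ is stable. *)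

(* Defs.v *)
From Stdlib Require Import List Arith Relations.

Set Implicit Arguments.
Unset Strict Implicit.

(* [Some a] is the visible action a, [None] is the silent action. *)
Definition label (Act : Type) : Type := option Act.
Definition tau {Act : Type} : label Act := None.

Section TransitionRelations.
Variables (Act State : Type).
Variable T : State -> label Act -> State -> Prop.
Variable F : State -> Prop.

Definition initials (p : State) (alpha : label Act) : Prop :=
  exists q, T p alpha q.

Definition stable (p : State) : Prop := ~ initials p tau.

Definition weak_stable (p q : State) : Prop :=
  clos_refl_trans State (fun x y => T x tau y) p q /\ stable q.

Inductive weak_stable_F : State -> State -> Prop :=
| wsF_stop p : ~ F p -> stable p -> weak_stable_F p p
| wsF_step p r q : ~ F p -> T p tau r -> weak_stable_F r q -> weak_stable_F p q.

Definition LTS1 (p : State) : Prop :=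
  (exists alpha, initials p alpha /\ forall q, T p alpha q -> F q) -> F p.

Definition LTS2 (p : State) : Prop :=
  ~ (exists q, weak_stable_F p q) -> F p.

End TransitionRelations.

Record lts (Act : Type) : Type := Lts {
  state : Type;
  trans : state -> label Act -> state -> Prop;
  incons : state -> Prop
}.

Definition logic_lts (Act : Type) (L : lts Act) : Prop :=
  forall p : state L,
    LTS1 (@trans Act L) (@incons Act L) p /\ LTS2 (@trans Act L) (@incons Act L) p.

Definition var : Type := nat.

(* A recursive specification is a list of equations (Y, t_Y). *)
Inductive term (Act : Type) : Type :=
| Nil
| Bot
| Pre (alpha : label Act) (t : term Act)
| Ext (t1 t2 : term Act)
| And (t1 t2 : term Act)
| Or (t1 t2 : term Act)
| Par (A : Act -> Prop) (t1 t2 : term Act)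
| Var (X : var)
| Rec (X : var) (E : list (var * term Act)).

Arguments Nil {Act}.
Arguments Bot {Act}.
Arguments Var {Act} X.

Definition spec (Act : Type) : Type := list (var * term Act).

Definition spec_vars (Act : Type) (E : spec Act) : list var := map fst E.

Inductive free (Act : Type) (Y : var) : term Act -> Prop :=
| free_var : free Y (Var Y)
| free_pre alpha t : free Y t -> free Y (Pre alpha t)
| free_ext_l t1 t2 : free Y t1 -> free Y (Ext t1 t2)
| free_ext_r t1 t2 : free Y t2 -> free Y (Ext t1 t2)
| free_and_l t1 t2 : free Y t1 -> free Y (And t1 t2)
| free_and_r t1 t2 : free Y t2 -> free Y (And t1 t2)
| free_or_l t1 t2 : free Y t1 -> free Y (Or t1 t2)
| free_or_r t1 t2 : free Y t2 -> free Y (Or t1 t2)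
| free_par_l A t1 t2 : free Y t1 -> free Y (Par A t1 t2)
| free_par_r A t1 t2 : free Y t2 -> free Y (Par A t1 t2)
| free_rec X E Z t :
    ~ In Y (spec_vars E) -> In (Z, t) E -> free Y t -> free Y (Rec X E).

Definition closed (Act : Type) (t : term Act) : Prop := forall Y, ~ free Y t.

(* Some free occurrence of Y in the term lies under no prefix and no
   disjunction: [Pre] and [Or] are deliberately absent. *)
Inductive unguarded (Act : Type) (Y : var) : term Act -> Prop :=
| ung_var : unguarded Y (Var Y)
| ung_ext_l t1 t2 : unguarded Y t1 -> unguarded Y (Ext t1 t2)
| ung_ext_r t1 t2 : unguarded Y t2 -> unguarded Y (Ext t1 t2)
| ung_and_l t1 t2 : unguarded Y t1 -> unguarded Y (And t1 t2)
| ung_and_r t1 t2 : unguarded Y t2 -> unguarded Y (And t1 t2)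
| ung_par_l A t1 t2 : unguarded Y t1 -> unguarded Y (Par A t1 t2)
| ung_par_r A t1 t2 : unguarded Y t2 -> unguarded Y (Par A t1 t2)
| ung_rec X E Z t :
    ~ In Y (spec_vars E) -> In (Z, t) E -> unguarded Y t -> unguarded Y (Rec X E).

Definition guarded (Act : Type) (E : spec Act) : Prop :=
  forall Z t Y, In (Z, t) E -> In Y (spec_vars E) -> ~ unguarded Y t.

(* Every recursive specification in the term, at any depth, has exactly one
   equation per variable, contains the variable it is entered at (hence is
   nonempty), and is guarded. *)
Inductive wf (Act : Type) : term Act -> Prop :=
| wf_nil : wf Nil
| wf_bot : wf Bot
| wf_pre alpha t : wf t -> wf (Pre alpha t)
| wf_ext t1 t2 : wf t1 -> wf t2 -> wf (Ext t1 t2)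
| wf_and t1 t2 : wf t1 -> wf t2 -> wf (And t1 t2)
| wf_or t1 t2 : wf t1 -> wf t2 -> wf (Or t1 t2)
| wf_par A t1 t2 : wf t1 -> wf t2 -> wf (Par A t1 t2)
| wf_Var X : wf (Var X)
| wf_rec X E :
    In X (spec_vars E) -> NoDup (spec_vars E) -> guarded E ->
    (forall Y t, In (Y, t) E -> wf t) -> wf (Rec X E).

Definition process (Act : Type) (t : term Act) : Prop := wf t /\ closed t.

(* Simultaneous substitution for free occurrences.  It does not rename bound
   variables: the transition rules only substitute closed terms, for which no
   capture can occur. *)
Definition shadow (Act : Type) (s : var -> term Act) (V : list var) (Y : var)
  : term Act :=
  if in_dec Nat.eq_dec Y V then Var Y else s Y.

Fixpoint subst (Act : Type) (s : var -> term Act) (t : term Act) : term Act :=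
  match t with
  | Nil => Nil
  | Bot => Bot
  | Pre alpha u => Pre alpha (subst s u)
  | Ext u v => Ext (subst s u) (subst s v)
  | And u v => And (subst s u) (subst s v)
  | Or u v => Or (subst s u) (subst s v)
  | Par A u v => Par A (subst s u) (subst s v)
  | Var Y => s Y
  | Rec X E =>
      Rec X (map (fun e => (fst e, subst (shadow s (map fst E)) (snd e))) E)
  end.

(* <t|E> *)
Definition unfold_in (Act : Type) (E : spec Act) (t : term Act) : term Act :=
  subst (fun Y => if in_dec Nat.eq_dec Y (spec_vars E) then Rec Y E else Var Y) t.

(* A candidate model: transitions and inconsistency predicate over all terms. *)
Record interp (Act : Type) : Type := Interp {
  itrans : term Act -> label Act -> term Act -> Prop;
  iincons : term Act -> Prop
}.

(* Derivability in the reduct of the specification by the candidate M: positive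
   premises are derived inductively, whereas negative premises and the ranges of
   the universally quantified premises of F are read off M. *)
Section Reduct.
Variables (Act : Type) (M : interp Act).

Inductive der_trans : term Act -> label Act -> term Act -> Prop :=
| tr_pre alpha x : der_trans (Pre alpha x) alpha x
| tr_ext_l a x1 x2 y1 :
    der_trans x1 (Some a) y1 -> stable (itrans M) x2 ->
    der_trans (Ext x1 x2) (Some a) y1
| tr_ext_r a x1 x2 y1 :
    der_trans x1 (Some a) y1 -> stable (itrans M) x2 ->
    der_trans (Ext x2 x1) (Some a) y1
| tr_ext_tau_l x1 x2 y1 :
    der_trans x1 tau y1 -> der_trans (Ext x1 x2) tau (Ext y1 x2)
| tr_ext_tau_r x1 x2 y1 :
    der_trans x1 tau y1 -> der_trans (Ext x2 x1) tau (Ext x2 y1)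
| tr_and_tau_l x1 x2 y1 :
    der_trans x1 tau y1 -> der_trans (And x1 x2) tau (And y1 x2)
| tr_and_tau_r x1 x2 y1 :
    der_trans x1 tau y1 -> der_trans (And x2 x1) tau (And x2 y1)
| tr_par_tau_l A x1 x2 y1 :
    der_trans x1 tau y1 -> der_trans (Par A x1 x2) tau (Par A y1 x2)
| tr_par_tau_r A x1 x2 y1 :
    der_trans x1 tau y1 -> der_trans (Par A x2 x1) tau (Par A x2 y1)
| tr_and a x1 x2 y1 y2 :
    der_trans x1 (Some a) y1 -> der_trans x2 (Some a) y2 ->
    der_trans (And x1 x2) (Some a) (And y1 y2)
| tr_par_sync A a x1 x2 y1 y2 :
    A a -> der_trans x1 (Some a) y1 -> der_trans x2 (Some a) y2 ->
    der_trans (Par A x1 x2) (Some a) (Par A y1 y2)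
| tr_par_l A a x1 x2 y1 :
    ~ A a -> der_trans x1 (Some a) y1 -> stable (itrans M) x2 ->
    der_trans (Par A x1 x2) (Some a) (Par A y1 x2)
| tr_par_r A a x1 x2 y1 :
    ~ A a -> der_trans x1 (Some a) y1 -> stable (itrans M) x2 ->
    der_trans (Par A x2 x1) (Some a) (Par A x2 y1)
| tr_or_l x1 x2 : der_trans (Or x1 x2) tau x1
| tr_or_r x1 x2 : der_trans (Or x1 x2) tau x2
| tr_rec alpha Y t E y :
    In (Y, t) E -> der_trans (unfold_in E t) alpha y ->
    der_trans (Rec Y E) alpha y.

Inductive der_incons : term Act -> Prop :=
| inc_bot : der_incons Bot
| inc_pre alpha x : der_incons x -> der_incons (Pre alpha x)
| inc_or x1 x2 : der_incons x1 -> der_incons x2 -> der_incons (Or x1 x2)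
| inc_ext_l x1 x2 : der_incons x1 -> der_incons (Ext x1 x2)
| inc_ext_r x1 x2 : der_incons x2 -> der_incons (Ext x1 x2)
| inc_par_l A x1 x2 : der_incons x1 -> der_incons (Par A x1 x2)
| inc_par_r A x1 x2 : der_incons x2 -> der_incons (Par A x1 x2)
| inc_and_l x1 x2 : der_incons x1 -> der_incons (And x1 x2)
| inc_and_r x1 x2 : der_incons x2 -> der_incons (And x1 x2)
| inc_and_init_l a x1 x2 y1 :
    stable (itrans M) (And x1 x2) ->
    der_trans x1 (Some a) y1 -> ~ initials (itrans M) x2 (Some a) ->
    der_incons (And x1 x2)
| inc_and_init_r a x1 x2 y2 :
    stable (itrans M) (And x1 x2) ->
    der_trans x2 (Some a) y2 -> ~ initials (itrans M) x1 (Some a) ->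
    der_incons (And x1 x2)
| inc_and_all alpha x1 x2 z :
    der_trans (And x1 x2) alpha z ->
    (forall y, itrans M (And x1 x2) alpha y -> der_incons y) ->
    der_incons (And x1 x2)
| inc_and_eps x1 x2 :
    (forall y, weak_stable (itrans M) (And x1 x2) y -> der_incons y) ->
    der_incons (And x1 x2)
| inc_rec Y t E :
    In (Y, t) E -> der_incons (unfold_in E t) -> der_incons (Rec Y E)
| inc_rec_eps Y E :
    (forall y, weak_stable (itrans M) (Rec Y E) y -> der_incons y) ->
    der_incons (Rec Y E).

End Reduct.

(* M is the least model of its own reduct. *)
Definition stable_model (Act : Type) (M : interp Act) : Prop :=
  (forall p alpha q, itrans M p alpha q <-> der_trans M p alpha q) /\
  (forall p, iincons M p <-> der_incons M p).

Definition interp_equiv (Act : Type) (M N : interp Act) : Prop :=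
  (forall p alpha q, itrans M p alpha q <-> itrans N p alpha q) /\
  (forall p, iincons M p <-> iincons N p).

(* Restricting to processes loses no transition: see [process_itrans]. *)
Definition LTS_CLLR (Act : Type) (M : interp Act) : lts Act :=
  Lts (state := { p : term Act | process p })
      (fun p alpha q => itrans M (proj1_sig p) alpha (proj1_sig q))
      (fun p => iincons M (proj1_sig p)).

(* tau-transitions involve no negative premise, visible ones only negate
   tau-transitions, and F only negates transitions. *)
Lemma der_trans_tau_indep (Act : Type) (M N : interp Act) p q :
  der_trans M p tau q -> der_trans N p tau q.
Proof.
intro H; remember tau as alpha eqn:e; revert e.
induction H; intro e; try discriminate e; subst;
  econstructor; solve [eauto].
Qed.

Lemma der_trans_mono (Act : Type) (M N : interp Act) :
  (forall p q, itrans N p tau q -> itrans M p tau q) ->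
  forall p alpha q, der_trans M p alpha q -> der_trans N p alpha q.
Proof.
intros MN.
assert (S : forall x, stable (itrans M) x -> stable (itrans N) x).
{ intros x Hx [y Hy]; apply Hx; exists y; auto. }
induction 1; econstructor; solve [eauto].
Qed.

Lemma stable_model_trans_unique (Act : Type) (M N : interp Act) :
  stable_model M -> stable_model N ->
  forall p alpha q, itrans M p alpha q -> itrans N p alpha q.
Proof.
intros [HM _] [HN _] p alpha q H.
apply HN; apply HM in H; revert H; apply der_trans_mono.
intros x y Hxy; apply HM, der_trans_tau_indep with N, HN, Hxy.
Qed.

Lemma der_incons_ext (Act : Type) (M N : interp Act) :
  (forall p alpha q, itrans M p alpha q <-> itrans N p alpha q) ->
  forall p, der_incons M p -> der_incons N p.
Proof.
intros MN.
assert (D : forall p alpha q, der_trans M p alpha q -> der_trans N p alpha q).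
{ apply der_trans_mono; intros p q; apply MN. }
assert (I : forall x alpha,
  initials (itrans N) x alpha -> initials (itrans M) x alpha).
{ intros x alpha [y Hy]; exists y; apply MN, Hy. }
assert (S : forall x, stable (itrans M) x -> stable (itrans N) x).
{ intros x Hx Hi; exact (Hx (I _ _ Hi)). }
assert (W : forall x y, weak_stable (itrans N) x y -> weak_stable (itrans M) x y).
{ intros x y [Hxy Hy]; split.
  - clear Hy; induction Hxy as [x y H | x | x y z _ IH1 _ IH2].
    + apply rt_step, MN, H.
    + apply rt_refl.
    + exact (rt_trans _ _ _ _ _ IH1 IH2).
  - intros [z Hz]; apply Hy; exists z; apply MN, Hz. }
induction 1.
all: try (econstructor; solve [eauto]).
- eapply inc_and_all; [eauto | intros y Hy; apply H1, MN, Hy].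
Qed.

Theorem stable_model_unique (Act : Type) (M N : interp Act) :
  stable_model M -> stable_model N -> interp_equiv M N.
Proof.
intros HM HN.
assert (T : forall p alpha q, itrans M p alpha q <-> itrans N p alpha q).
{ split; apply stable_model_trans_unique; assumption. }
split; [exact T | intro p].
destruct HM as [_ HM], HN as [_ HN]; split; intro H.
- apply HN, (der_incons_ext T), HM, H.
- apply HM, (@der_incons_ext _ N M); [intros; symmetry; apply T | apply HN, H].
Qed.

Theorem stable_model_exists (Act : Type) : exists M : interp Act, stable_model M.
Proof.
pose (M0 := @Interp Act (fun _ _ _ => False) (fun _ => False)).
pose (M1 := Interp (der_trans M0) (fun _ => False)).
pose (M2 := Interp (der_trans M1) (fun _ => False)).
exists (Interp (der_trans M1) (der_incons M2)); split.
- split; apply der_trans_mono; intros x y; apply der_trans_tau_indep.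
- split; apply der_incons_ext; reflexivity.
Qed.

Section TermInd.
Variables (Act : Type) (P : term Act -> Prop).
Hypothesis Hnil : P Nil.
Hypothesis Hbot : P Bot.
Hypothesis Hpre : forall alpha t, P t -> P (Pre alpha t).
Hypothesis Hext : forall t1 t2, P t1 -> P t2 -> P (Ext t1 t2).
Hypothesis Hand : forall t1 t2, P t1 -> P t2 -> P (And t1 t2).
Hypothesis Hor : forall t1 t2, P t1 -> P t2 -> P (Or t1 t2).
Hypothesis Hpar : forall A t1 t2, P t1 -> P t2 -> P (Par A t1 t2).
Hypothesis Hvar : forall X, P (Var X).
Hypothesis Hrec : forall X E, (forall Y t, In (Y, t) E -> P t) -> P (Rec X E).

Fixpoint term_nested_ind (t : term Act) : P t.
Proof.
destruct t as [| | | | | | | | X E];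
  [apply Hnil | apply Hbot | apply Hpre | apply Hext | apply Hand | apply Hor
  | apply Hpar | apply Hvar | apply Hrec]; try apply term_nested_ind.
 induction E as [| [Z u] E IH]; simpl; [contradiction |].
intros Y t [e | H]; [| exact (IH _ _ H)].
injection e; intros <- _; apply term_nested_ind.
Defined.
End TermInd.

Lemma unguarded_free (Act : Type) (Y : var) (t : term Act) :
  unguarded Y t -> free Y t.
Proof. induction 1; econstructor; solve [eauto]. Qed.

Lemma spec_vars_map (Act : Type) (f : term Act -> term Act) (E : spec Act) :
  spec_vars (map (fun e => (fst e, f (snd e))) E) = spec_vars E.
Proof. unfold spec_vars; rewrite map_map; reflexivity. Qed.

Definition closing (Act : Type) (s : var -> term Act) : Prop :=
  forall Z, s Z = Var Z \/ closed (s Z).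

Lemma closing_shadow (Act : Type) (s : var -> term Act) V :
  closing s -> closing (shadow s V).
Proof.
intros H Z; unfold shadow; destruct (in_dec _ _ _); [left; reflexivity | apply H].
Qed.

Lemma free_subst (Act : Type) (t : term Act) : forall (s : var -> term Act) Y,
  closing s -> free Y (subst s t) -> free Y t /\ s Y = Var Y.
Proof.
induction t as [| | | | | | | X | X E IH] using term_nested_ind;
  intros s Y C H; simpl in H; try (inversion H; subst; fail).
all: try (inversion H; subst;
  match goal with
  | I : forall s Y, _ -> free Y (subst s ?u) -> _, G : free _ (subst _ ?u) |- _ =>
      destruct (I _ _ C G); split; [econstructor; solve [eauto] | assumption]
  end).
- destruct (C X) as [e | K]; [| destruct (K _ H)].
  rewrite e in H; inversion H; subst; split; [constructor | exact e].
- inversion H as [| | | | | | | | | | X' E' Z u N I G]; subst.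
  rewrite (spec_vars_map (subst (shadow s (spec_vars E)))) in N.
  apply in_map_iff in I; destruct I as [[Z' u'] [e I]]; injection e; intros <- <-.
  destruct (IH _ _ I _ _ (closing_shadow (map fst E) C) G) as [G1 G2].
  split; [exact (free_rec X N I G1) |].
  unfold shadow in G2; destruct (in_dec _ _ _) as [J |]; [| exact G2].
  destruct (N J).
Qed.

Lemma unguarded_subst (Act : Type) (t : term Act) : forall (s : var -> term Act) Y,
  closing s -> unguarded Y (subst s t) -> unguarded Y t.
Proof.
induction t as [| | | | | | | X | X E IH] using term_nested_ind;
  intros s Y C H; simpl in H; try (inversion H; subst; fail).
all: try (inversion H; subst; econstructor; solve [eauto]).
- destruct (C X) as [e | K]; [| destruct (K _ (unguarded_free H))].
  rewrite e in H; exact H.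
- inversion H as [| | | | | | | X' E' Z u N I G]; subst.
  rewrite (spec_vars_map (subst (shadow s (spec_vars E)))) in N.
  apply in_map_iff in I; destruct I as [[Z' u'] [e I]]; injection e; intros <- <-.
  exact (ung_rec X N I (IH _ _ I _ _ (closing_shadow (map fst E) C) G)).
Qed.

Lemma wf_subst (Act : Type) (t : term Act) : forall s : var -> term Act,
  closing s -> (forall Z, wf (s Z)) -> wf t -> wf (subst s t).
Proof.
induction t as [| | | | | | | X | X E IH] using term_nested_ind;
  intros s C W H; simpl; auto; try (inversion H; subst; constructor; auto; fail).
inversion H as [| | | | | | | | X' E' HX ND G HE]; subst.
assert (e := spec_vars_map (subst (shadow s (spec_vars E))) E).
unfold spec_vars at 2 in e; constructor.
- rewrite e; exact HX.
- rewrite e; exact ND.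
- intros Z u Y I J K; rewrite e in J.
  apply in_map_iff in I; destruct I as [[Z' u'] [e' I]].
  injection e'; intros <- <-.
  exact (G _ _ _ I J (unguarded_subst (closing_shadow (map fst E) C) K)).
- intros Z u I; apply in_map_iff in I; destruct I as [[Z' u'] [e' I]].
  injection e'; intros <- <-; apply (IH _ _ I).
  + apply closing_shadow, C.
  + intro Y; unfold shadow; destruct (in_dec _ _ _); [constructor | apply W].
  + exact (HE _ _ I).
Qed.

Lemma process_rec_any (Act : Type) X Y (E : spec Act) :
  process (Rec X E) -> In Y (spec_vars E) -> process (Rec Y E).
Proof.
intros [W C] H; split.
- inversion W; subst; constructor; assumption.
- intros Z K; inversion K; subst; apply (C Z); econstructor; solve [eauto].
Qed.

Lemma process_unfold (Act : Type) X (E : spec Act) Y t :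
  process (Rec X E) -> In (Y, t) E -> process (unfold_in E t).
Proof.
intros H I.
assert (R : closing (fun Y => if in_dec Nat.eq_dec Y (spec_vars E) then Rec Y E else Var Y)).
{ intro Z; destruct (in_dec _ _ _); [right | left; reflexivity].
  eapply process_rec_any; eassumption. }
split.
- apply wf_subst; [exact R | |].
  + intro Z; destruct (in_dec _ _ _); [| constructor].
    eapply process_rec_any; eassumption.
  + destruct H as [W _]; inversion W; eauto.
- intros Z K; destruct (free_subst R K) as [K1 K2].
  destruct (in_dec _ _ _) as [| N]; [discriminate K2 |].
  destruct H as [_ C]; exact (C _ (free_rec X N I K1)).
Qed.

Lemma process_der_trans (Act : Type) (M : interp Act) p alpha q :
  der_trans M p alpha q -> process p -> process q.
Proof.
assert (sub : forall (t u : term Act), (wf t -> wf u) ->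
  (forall Y, free Y u -> free Y t) -> process t -> process u).
{ intros t u W F [H1 H2]; split; [auto | intros Y K; exact (H2 _ (F _ K))]. }
assert (bin : forall (t t1 t2 : term Act),
  (wf t1 -> wf t2 -> wf t) -> (forall Y, free Y t -> free Y t1 \/ free Y t2) ->
  process t1 -> process t2 -> process t).
{ intros t t1 t2 W F [H1 H2] [H3 H4]; split; [auto |].
  intros Y K; destruct (F _ K) as [K1 | K1]; [exact (H2 _ K1) | exact (H4 _ K1)]. }
assert (parts : forall (c : term Act -> term Act -> term Act) t1 t2,
  (wf (c t1 t2) -> wf t1 /\ wf t2) ->
  (forall Y, free Y t1 -> free Y (c t1 t2)) ->
  (forall Y, free Y t2 -> free Y (c t1 t2)) ->
  process (c t1 t2) -> process t1 /\ process t2).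
{ intros c t1 t2 W F1 F2 H; split; eapply sub; try exact H;
    try assumption; intro K; apply W, K. }
induction 1; intro Hp;
  try (match type of Hp with
  | process (?c ?u ?v) => destruct (parts c u v) as [P1 P2];
      [ intro W; inversion W; split; assumption
      | intros; econstructor; solve [eauto] | intros; econstructor; solve [eauto]
      | exact Hp | ]
  end);
  try solve [auto];
  try match goal with
  | |- process (_ ?u ?v) => apply (bin _ u v);
      [ intros; constructor; assumption
      | intros Y K; inversion K; subst; auto | auto | auto ]
  end.
{ eapply sub; [| | exact Hp];
    [intro W; inversion W; assumption | intros; econstructor; solve [eauto]]. }
apply IHder_trans; eapply process_unfold; eassumption.
Qed.

Theorem process_itrans (Act : Type) (M : interp Act) p alpha q :
  stable_model M -> process p -> itrans M p alpha q -> process q.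
Proof. intros [HM _] Hp H; apply HM in H; exact (process_der_trans H Hp). Qed.

(* Main.v *)
Require Import Defs.
From Stdlib Require Import List Relations Classical.

(** If every stable state reachable from [p] by silent steps is inconsistent,
    then so is [p]: for conjunctions and recursive calls this is a predicate
    rule, and every other operator propagates it structurally.  Together with
    the fact that silent and visible transitions exclude each other, this makes
    inconsistency closed under silent steps; hence a silent path to a consistent
    stable state meets only consistent states, which gives (LTS2).  (LTS1) is an
    induction on the derivation of a transition. *)

Section StableModel.
Variables (Act : Type) (M : interp Act).
Hypothesis HM : stable_model M.

Local Notation T := (itrans M).
(** Inconsistency is taken as derivability, which allows induction and inversion on the predicate
    rules; in a stable model it coincides with [iincons M]. *)
Local Notation F := (der_incons M).
Local Notation tau_steps := (clos_refl_trans _ (fun x y => T x tau y)).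

(** * Inconsistency inherited from successors *)

Lemma itransE p alpha q : T p alpha q <-> der_trans M p alpha q.
Proof. apply HM. Qed.

Lemma iinconsE p : iincons M p <-> F p.
Proof. apply HM. Qed.

(** For a conjunction this is the rule [inc_and_all]. If a step keeps the operator [Ext] or [Par],
    an inconsistent successor has an inconsistent component: either the idle component is
    inconsistent already, or all successors of the moving one are, and the induction hypothesis
    applies to it. *)
Lemma incons_of_initials p alpha q :
  der_trans M p alpha q -> (forall r, der_trans M p alpha r -> F r) -> F p.
Proof.
induction 1 as
  [ alpha x | a x1 x2 y1 H IH S | a x1 x2 y1 H IH S
  | x1 x2 y1 H IH | x1 x2 y1 H IH | x1 x2 y1 H IH | x1 x2 y1 H IH
  | A x1 x2 y1 H IH | A x1 x2 y1 H IH | a x1 x2 y1 y2 H1 IH1 H2 IH2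
  | A a x1 x2 y1 y2 Aa H1 IH1 H2 IH2
  | A a x1 x2 y1 Aa H IH S | A a x1 x2 y1 Aa H IH S
  | x1 x2 | x1 x2 | alpha Y t E y I H IH ]; intro HF.
- apply inc_pre, HF, tr_pre.
- apply inc_ext_l, IH; intros r Hr; apply HF, tr_ext_l; assumption.
- apply inc_ext_r, IH; intros r Hr; apply HF, tr_ext_r; assumption.
- destruct (classic (F x2)) as [K | K]; [apply inc_ext_r, K |].
  apply inc_ext_l, IH; intros r Hr.
  pose proof (HF _ (tr_ext_tau_l x2 Hr)) as G; inversion G; tauto.
- destruct (classic (F x2)) as [K | K]; [apply inc_ext_l, K |].
  apply inc_ext_r, IH; intros r Hr.
  pose proof (HF _ (tr_ext_tau_r x2 Hr)) as G; inversion G; tauto.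
- apply (inc_and_all (tr_and_tau_l x2 H)); intros r Hr; apply HF, itransE, Hr.
- apply (inc_and_all (tr_and_tau_r x2 H)); intros r Hr; apply HF, itransE, Hr.
- destruct (classic (F x2)) as [K | K]; [apply inc_par_r, K |].
  apply inc_par_l, IH; intros r Hr.
  pose proof (HF _ (tr_par_tau_l A x2 Hr)) as G; inversion G; tauto.
- destruct (classic (F x2)) as [K | K]; [apply inc_par_l, K |].
  apply inc_par_r, IH; intros r Hr.
  pose proof (HF _ (tr_par_tau_r A x2 Hr)) as G; inversion G; tauto.
- apply (inc_and_all (tr_and H1 H2)); intros r Hr; apply HF, itransE, Hr.
(* In a synchronisation all pairs [Par A r1 r2] are successors; a consistent [r2] would force every
   [r1], hence [x1], to be inconsistent. *)
- destruct (classic (F x1)) as [K | K]; [apply inc_par_l, K |].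
  apply inc_par_r, IH2; intros r2 Hr2.
  apply NNPP; intro K2; apply K, IH1; intros r1 Hr1.
  pose proof (HF _ (tr_par_sync Aa Hr1 Hr2)) as G; inversion G; tauto.
- destruct (classic (F x2)) as [K | K]; [apply inc_par_r, K |].
  apply inc_par_l, IH; intros r Hr.
  pose proof (HF _ (tr_par_l Aa Hr S)) as G; inversion G; tauto.
- destruct (classic (F x2)) as [K | K]; [apply inc_par_l, K |].
  apply inc_par_r, IH; intros r Hr.
  pose proof (HF _ (tr_par_r Aa Hr S)) as G; inversion G; tauto.
- apply inc_or; apply HF; constructor.
- apply inc_or; apply HF; constructor.
- apply (inc_rec I), IH; intros r Hr; apply HF, (tr_rec I Hr).
Qed.

(** * Reaching stable states by silent steps *)

Lemma tau_steps_context (C : term Act -> term Act) x y :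
  (forall u v, der_trans M u tau v -> der_trans M (C u) tau (C v)) ->
  tau_steps x y -> tau_steps (C x) (C y).
Proof.
intros HC; induction 1 as [x y H | x | x y z _ IH1 _ IH2].
- apply rt_step, itransE, HC, itransE, H.
- apply rt_refl.
- exact (rt_trans _ _ _ _ _ IH1 IH2).
Qed.

Lemma weak_stable_step p q r : T p tau q -> weak_stable T q r -> weak_stable T p r.
Proof.
intros H [Hqr Hr]; split; [| exact Hr].
exact (rt_trans _ _ _ _ _ (rt_step _ _ _ _ H) Hqr).
Qed.

Lemma weak_stable_refl p : stable T p -> weak_stable T p p.
Proof. split; [apply rt_refl | assumption]. Qed.

Lemma weak_stable_ext x1 x2 y1 y2 :
  weak_stable T x1 y1 -> weak_stable T x2 y2 ->
  weak_stable T (Ext x1 x2) (Ext y1 y2).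
Proof.
intros [H1 S1] [H2 S2]; split.
- apply rt_trans with (Ext y1 x2).
  + apply (tau_steps_context (fun u => Ext u x2)); [| exact H1].
    intros; apply tr_ext_tau_l; assumption.
  + apply tau_steps_context; [| exact H2].
    intros; apply tr_ext_tau_r; assumption.
- intros [z Hz]; apply itransE in Hz; inversion Hz; subst;
    [apply S1 | apply S2]; eexists; apply itransE; eassumption.
Qed.

Lemma weak_stable_par A x1 x2 y1 y2 :
  weak_stable T x1 y1 -> weak_stable T x2 y2 ->
  weak_stable T (Par A x1 x2) (Par A y1 y2).
Proof.
intros [H1 S1] [H2 S2]; split.
- apply rt_trans with (Par A y1 x2).
  + apply (tau_steps_context (fun u => Par A u x2)); [| exact H1].
    intros; apply tr_par_tau_l; assumption.
  + apply tau_steps_context; [| exact H2].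
    intros; apply tr_par_tau_r; assumption.
- intros [z Hz]; apply itransE in Hz; inversion Hz; subst;
    [apply S1 | apply S2]; eexists; apply itransE; eassumption.
Qed.

(** The contrapositive form lets structural induction build [q]. Combining consistent stable states
    by [Ext] or [Par] gives a stable state, consistent because the only predicate rules for these
    operators concern a component. *)
Lemma consistent_weak_stable p :
  ~ F p -> exists q, weak_stable T p q /\ ~ F q.
Proof.
assert (stop : forall t, stable T t -> ~ F t ->
  exists q, weak_stable T t q /\ ~ F q).
{ intros t S N; exists t; split; [apply weak_stable_refl, S | exact N]. }
induction p as [| | alpha t IH | t1 t2 IH1 IH2 | t1 t2 IH1 IH2 | t1 t2 IH1 IH2
  | A t1 t2 IH1 IH2 | X | X E IH] using term_nested_ind; intro N.
- apply stop; [| exact N].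
  intros [z Hz]; apply itransE in Hz; inversion Hz.
- destruct N; apply inc_bot.
- destruct alpha as [a |].
  + apply stop; [| exact N].
    intros [z Hz]; apply itransE in Hz; inversion Hz.
  + destruct IH as [q [Hq Nq]]; [intro K; apply N, inc_pre, K |].
    exists q; split; [| exact Nq].
    refine (weak_stable_step _ _ _ _ Hq); apply itransE, tr_pre.
- destruct IH1 as [q1 [H1 N1]]; [intro K; apply N, inc_ext_l, K |].
  destruct IH2 as [q2 [H2 N2]]; [intro K; apply N, inc_ext_r, K |].
  exists (Ext q1 q2); split; [apply weak_stable_ext; assumption |].
  intro K; inversion K; tauto.
- apply NNPP; intro K; apply N, inc_and_eps; intros y Hy.
  apply NNPP; intro Ny; apply K; exists y; split; assumption.
- assert (D : ~ F t1 \/ ~ F t2).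
  { apply not_and_or; intros [K1 K2]; apply N, inc_or; assumption. }
  destruct D as [D | D]; [destruct (IH1 D) as [q [Hq Nq]] |
    destruct (IH2 D) as [q [Hq Nq]]]; exists q; split; try exact Nq;
    refine (weak_stable_step _ _ _ _ Hq); apply itransE; constructor.
- destruct IH1 as [q1 [H1 N1]]; [intro K; apply N, inc_par_l, K |].
  destruct IH2 as [q2 [H2 N2]]; [intro K; apply N, inc_par_r, K |].
  exists (Par A q1 q2); split; [apply weak_stable_par; assumption |].
  intro K; inversion K; tauto.
- apply stop; [| exact N].
  intros [z Hz]; apply itransE in Hz; inversion Hz.
(* The recursion is not unfolded: [inc_rec_eps] speaks of the stable states reachable from the call
   itself, so induction on terms suffices. *)
- apply NNPP; intro K; apply N, inc_rec_eps; intros y Hy.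
  apply NNPP; intro Ny; apply K; exists y; split; assumption.
Qed.

(** Extends [inc_and_eps] and [inc_rec_eps] to all terms. *)
Lemma incons_of_weak_stable p : (forall y, weak_stable T p y -> F y) -> F p.
Proof.
intro H; apply NNPP; intro N.
destruct (consistent_weak_stable p N) as [q [Hq Nq]]; exact (Nq (H _ Hq)).
Qed.

(** * Inconsistency along silent steps of processes *)

Lemma process_ext (t1 t2 : term Act) :
  process (Ext t1 t2) -> process t1 /\ process t2.
Proof.
intros [W C]; inversion W; subst.
split; split; try assumption; intros Y K; apply (C Y);
  [apply free_ext_l | apply free_ext_r]; exact K.
Qed.

Lemma process_and (t1 t2 : term Act) :
  process (And t1 t2) -> process t1 /\ process t2.
Proof.
intros [W C]; inversion W; subst.
split; split; try assumption; intros Y K; apply (C Y);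
  [apply free_and_l | apply free_and_r]; exact K.
Qed.

Lemma process_par A (t1 t2 : term Act) :
  process (Par A t1 t2) -> process t1 /\ process t2.
Proof.
intros [W C]; inversion W; subst.
split; split; try assumption; intros Y K; apply (C Y);
  [apply free_par_l | apply free_par_r]; exact K.
Qed.

(** Ensures that two derivations from the same recursive call concern the same unfolding. *)
Lemma equation_unique (E : spec Act) Y t u :
  NoDup (spec_vars E) -> In (Y, t) E -> In (Y, u) E -> t = u.
Proof.
induction E as [| [Z v] E IH]; simpl; [contradiction |].
intros N; inversion N as [| Z' V N1 N2]; subst.
assert (K : forall w, In (Z, w) E -> False).
{ intros w Hw; apply N1; exact (in_map fst _ _ Hw). }
intros [e | I] [e' | J]; [congruence | | | auto].
- injection e; intros; subst; destruct (K _ J).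
- injection e'; intros; subst; destruct (K _ I).
Qed.

Lemma process_rec_NoDup X (E : spec Act) : process (Rec X E) -> NoDup (spec_vars E).
Proof. intros [W _]; inversion W; assumption. Qed.

(** In a visible step the moving components move visibly, hence have no silent step by induction,
    and an idle component is stable by a negative premise. *)
Lemma no_tau_of_visible p alpha q :
  der_trans M p alpha q -> process p -> alpha <> tau ->
  forall r, ~ der_trans M p tau r.
Proof.
assert (S : forall x y, stable T x -> ~ der_trans M x tau y).
{ intros x y Hx H; apply Hx; exists y; apply itransE, H. }
induction 1; intros Hp Na r K; try (apply Na; reflexivity).
all: try (inversion K; subst; congruence).
all: try match type of Hp with
  | process (Ext _ _) => apply process_ext in Hp; destruct Hp
  | process (And _ _) => apply process_and in Hp; destruct Hp
  | process (Par _ _ _) => apply process_par in Hp; destruct Hp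
  end.
all: inversion K; subst.
all: try (eapply S; eassumption).
all: try match goal with
  | I : process ?x -> _, H : der_trans M ?x tau _ |- _ =>
      refine (I _ _ _ H); [assumption | discriminate]
  end.
match goal with H1 : In (Y, t) E, H2 : In (Y, ?u) E |- _ =>
  assert (t = u) as <- by
    (exact (equation_unique _ _ _ _ (process_rec_NoDup _ _ Hp) H1 H2)) end.
refine (IHder_trans _ Na _ _); [| eassumption].
eapply process_unfold; eassumption.
Qed.

(** Inconsistency of the moving component passes to its successor by induction, and that of an idle
    component stays in place. *)
Lemma incons_tau_closed p q : F p -> process p -> der_trans M p tau q -> F q.
Proof.
intros HF Hp H; remember tau as alpha eqn:e.
(* Stable states reachable from [y] are reachable from [x], which settles the rules about reachable
   stable states. *)
assert (eps : forall x y, der_trans M x tau y ->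
  (forall z, weak_stable T x z -> F z) -> F y).
{ intros x y Hxy K; apply incons_of_weak_stable; intros z Hz.
  apply K; refine (weak_stable_step _ _ _ _ Hz); apply itransE, Hxy. }
(* A silent step excludes the rules comparing initial actions, which require stability, and the rule
   [inc_and_all] at a visible label. *)
assert (conj : forall x1 x2 y, process (And x1 x2) ->
  der_trans M (And x1 x2) tau y -> F (And x1 x2) -> F x1 \/ F x2 \/ F y).
{ intros x1 x2 y P Hy K; inversion K; subst; auto; right; right.
  - match goal with S : stable _ _ |- _ => destruct S end.
    exists y; apply itransE, Hy.
  - match goal with S : stable _ _ |- _ => destruct S end.
    exists y; apply itransE, Hy.
  - match goal with D : der_trans M _ ?b _, G : forall y, _ -> F y |- _ =>
      destruct b as [b |];
        [ destruct (no_tau_of_visible _ _ _ D P ltac:(discriminate) _ Hy)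
        | apply G, itransE, Hy ] end.
  - eapply eps; eassumption. }
revert HF Hp e; induction H; intros HF Hp e; try discriminate e; subst.
- inversion HF; assumption.
- apply process_ext in Hp; destruct Hp.
  inversion HF; subst; [apply inc_ext_l | apply inc_ext_r]; auto.
- apply process_ext in Hp; destruct Hp.
  inversion HF; subst; [apply inc_ext_l | apply inc_ext_r]; auto.
- destruct (process_and _ _ Hp).
  destruct (conj _ _ _ Hp (tr_and_tau_l x2 H) HF) as [K | [K | K]];
    [apply inc_and_l | apply inc_and_r |]; auto.
- destruct (process_and _ _ Hp).
  destruct (conj _ _ _ Hp (tr_and_tau_r x2 H) HF) as [K | [K | K]];
    [apply inc_and_l | apply inc_and_r |]; auto.
- apply process_par in Hp; destruct Hp.
  inversion HF; subst; [apply inc_par_l | apply inc_par_r]; auto.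
- apply process_par in Hp; destruct Hp.
  inversion HF; subst; [apply inc_par_l | apply inc_par_r]; auto.
- inversion HF; assumption.
- inversion HF; assumption.
- inversion HF; subst.
  + match goal with H1 : In (Y, t) E, H2 : In (Y, ?u) E |- _ =>
      assert (t = u) as <- by
        (exact (equation_unique _ _ _ _ (process_rec_NoDup _ _ Hp) H1 H2)) end.
    apply IHder_trans; auto; eapply process_unfold; eassumption.
  + exact (eps _ _ (tr_rec H H0) H2).
Qed.

(** * Consistent silent paths and the transition system on processes *)

Lemma consistent_weak_stable_F p :
  process p -> ~ F p -> exists q, weak_stable_F T F p q.
Proof.
intros Hp Np; destruct (consistent_weak_stable p Np) as [q [[Hpq Sq] Nq]].
exists q; clear Np; apply clos_rt_rt1n in Hpq.
(* Consistency joins the induction statement because it is pulled back from the end of the path, one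
   step at a time, by the contrapositive of [incons_tau_closed]. *)
enough (~ F p /\ weak_stable_F T F p q) by tauto.
revert Hp; induction Hpq as [p | p r q H _ IH]; intro Hp.
- split; [exact Nq | apply wsF_stop; assumption].
- destruct (IH Sq Nq (process_itrans HM Hp H)) as [Nr Hr].
  assert (Np : ~ F p).
  { intro K; apply Nr, (incons_tau_closed _ _ K Hp), itransE, H. }
  split; [exact Np | exact (wsF_step Np H Hr)].
Qed.

(** The states of [LTS_CLLR] carry a proof of [process], which transitions preserve along the path;
    stability carries over because a transition between processes is one between the underlying
    terms. *)
Lemma weak_stable_F_process p q :
  weak_stable_F T F p q -> forall Hp : process p, exists q' : {t | process t},
    weak_stable_F (@trans _ (LTS_CLLR M)) (@incons _ (LTS_CLLR M))
      (exist _ p Hp) q'.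
Proof.
induction 1 as [p Np Sp | p r q Np Hpr _ IH]; intro Hp.
- exists (exist _ p Hp); apply wsF_stop.
  + intro K; apply Np, iinconsE, K.
  + intros [[z Pz] Hz]; apply Sp; exists z; exact Hz.
- destruct (IH (process_itrans HM Hp Hpr)) as [q' Hq'].
  exists q'; refine (wsF_step _ _ Hq'); [| exact Hpr].
  intro K; apply Np, iinconsE, K.
Qed.

End StableModel.

Theorem mainTheorem6 (Act : Type) (M : interp Act) (HM : stable_model M) :
  logic_lts (LTS_CLLR M).
Proof.
intros [p Hp]; split.
- intros [alpha [[[q Hq] Hpq] HF]]; apply (iinconsE _ _ HM).
  apply (incons_of_initials _ _ HM p alpha q).
  + apply (itransE _ _ HM), Hpq.
  (* [HF] ranges over processes only, so the successor [r] must first be shown to be one. *)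
  + intros r Hr; apply (itransE _ _ HM) in Hr.
    apply (iinconsE _ _ HM).
    exact (HF (exist _ r (process_itrans HM Hp Hr)) Hr).
- intro N; apply (iinconsE _ _ HM), NNPP; intro K.
  destruct (consistent_weak_stable_F _ _ HM p Hp K) as [q Hq].
  exact (N (weak_stable_F_process _ _ HM _ _ Hq Hp)).
Qed.
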